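(* Let $\rho = (1,k-1,1)$. For every integer $k \geq 1$, $$C_{3,5}^k = \vert \mathbb{S}(5^3,\rho) \vert = \frac{15625 k^8 - 10092 k^7 + 10258 k^6 - 72 k^5 + 5473 k^4 - 204 k^3 + 2628 k^2}{576} + 1.$$
   Context: $n^3$ denotes the three-row rectangular shape $(n,n,n)$. The Young diagram of shape $\lambda=(\lambda_1,\dots,\lambda_m)$ is the left-justified array with $\lambda_i$ cells in the $i$-th row from the top; $(i,j)$ is the cell in row $i$, column $j$. $\mathbb{S}(\lambda,\rho)$ is the set of standard set-valued Young tableaux of shape $\lambda$ and row-constant density $\rho=(\rho_1,\dots,\rho_m)$: assignments of the integers $1,\dots,M$, $M=\sum_i\lambda_i\rho_i$, to the cells so that each cell in row $i$ receives precisely $\rho_i$ integers (unordered within the cell), and for each cell $(i,j)$ every integer in it is smaller than every integer in the cells $(i+1,j)$ and $(i,j+1)$. In the degenerate case $k=1$ the middle-row cells are empty and the tableaux are identified with standard Young tableaux formed by the first and third rows, i.e. the order condition is read as: every integer in cell $(i,j)$ is smaller than every integer in any other cell $(i',j')$ with $i'\ge i$, $j'\ge j$ (for positive densities this is equivalent to the condition above). The numbers $C^k_{3,n} := \vert \mathbb{S}(n^3,\rho)\vert$ with $\rho=(1,k-1,1)$ are called the three-dimensional $k$-Catalan numbers. *)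

(* Defs.v *)
From HB Require Import structures.
From mathcomp Require Import all_boot all_order all_algebra.

Set Implicit Arguments.
Unset Strict Implicit.
Unset Printing Implicit Defensive.

(* Rows and columns are numbered from 0. *)
Definition cell (m : nat) (lam : m.-tuple nat) : finType :=
  {i : 'I_m & 'I_(tnth lam i)}.

Definition cell_row (m : nat) (lam : m.-tuple nat) (c : cell lam) : nat :=
  tag c.

Definition cell_col (m : nat) (lam : m.-tuple nat) (c : cell lam) : nat :=
  tagged c.

(* d is (i+1, j) or (i, j+1) when c is (i, j). *)
Definition adjacent (m : nat) (lam : m.-tuple nat) : rel (cell lam) :=
  fun c d =>
    ((cell_row d == (cell_row c).+1) && (cell_col d == cell_col c))
    || ((cell_row d == cell_row c) && (cell_col d == (cell_col c).+1)).

Definition southeast (m : nat) (lam : m.-tuple nat) : rel (cell lam) :=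
  fun c d =>
    [&& d != c, cell_row c <= cell_row d & cell_col c <= cell_col d].

(* Comparing adjacent cells only would lose the constraints that pass through
   empty cells, so when some row has density 0 all comparable pairs of cells
   are compared. *)
Definition constrained (m : nat) (lam rho : m.-tuple nat) : rel (cell lam) :=
  if [forall i, 0 < tnth rho i] then @adjacent m lam else @southeast m lam.

Definition total_entries (m : nat) (lam rho : m.-tuple nat) : nat :=
  \sum_(i < m) tnth lam i * tnth rho i.

(* A filling sends each entry to the cell containing it; the ordinal x stands
   for the integer x + 1. *)
Definition filling (m : nat) (lam rho : m.-tuple nat) : finType :=
  {ffun 'I_(total_entries lam rho) -> cell lam}.

Definition standard (m : nat) (lam rho : m.-tuple nat) (T : filling lam rho) :
    bool :=
  [forall c : cell lam, #|[set x | T x == c]| == tnth rho (tag c)]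
  && [forall x, forall y, constrained rho (T x) (T y) ==> (x < y)].

Definition svt (m : nat) (lam rho : m.-tuple nat) : {set filling lam rho} :=
  [set T | standard T].

Definition rect3 (n : nat) : 3.-tuple nat := [tuple n; n; n].

(* C^k_{3,n}; meaningful for k >= 1. *)
Definition catalan3 (k n : nat) : nat :=
  #|svt (rect3 n) [tuple 1; k - 1; 1]|.

(* Main.v *)
From Stdlib Require Import NArith.
Require Import Defs.
From mathcomp Require Import all_boot all_order all_algebra.
From mathcomp Require Import ring lra zify.

Set Implicit Arguments.
Unset Strict Implicit.
Unset Printing Implicit Defensive.

Import Order.TTheory GRing.Theory Num.Theory.

(* Reading off the row of every entry turns a tableau into a word with n letters 0,
   m n letters 1 and n letters 2 (m = k - 1), all of whose prefixes (i, g, j) satisfy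
   g <= m i, j <= i and m j <= g; conversely the column of an entry is recovered by
   dividing its rank within its row by the density. So C^k_{3,n} counts lattice paths,
   by the obvious three-term recurrence. On a strip m t <= g <= m (t + 1) the set of
   admissible (i, j) is constant, and there the counts are polynomials in m and g - m t
   of total degree less than i + j; at the end point of the paths this leaves a
   polynomial in m of degree at most 2 n - 2, valid for m > 0. For n = 5 it is pinned
   down by its values at m = 1, ..., 9; the value at m = 0 is computed apart. *)

(** * Tableaux and ballot words *)

Lemma cell_eqE (R : nat) (lam : R.-tuple nat) (c d : cell lam) :
  (c == d) = (cell_row c == cell_row d) && (cell_col c == cell_col d).
Proof.
apply/eqP/andP => [->|]; first by rewrite !eqxx.
case: c d => [i x] [i' y] /= []; rewrite /cell_row /= val_eqE => /eqP eq_i.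
case: _ / eq_i y => y.
by rewrite /cell_col /= => /eqP/val_inj ->.
Qed.

Lemma cell_exists (R n : nat) (lam : R.-tuple nat) (i : 'I_R) (j : nat) :
  (forall i, tnth lam i = n) -> j < n ->
  exists2 c : cell lam, tag c = i & cell_col c = j.
Proof.
move=> lamE; rewrite -(lamE i) => jn.
by exists (Tagged (fun i => 'I_(tnth lam i)) (Ordinal jn)).
Qed.

Lemma adjacent_southeast (R : nat) (lam : R.-tuple nat) (c d : cell lam) :
  adjacent c d -> southeast c d.
Proof.
rewrite /adjacent /southeast cell_eqE.
by case/orP => /andP[/eqP -> /eqP ->]; lia.
Qed.

(** Reduces both readings of [constrained] to [southeast]. When all densities are positive, two
    comparable cells are joined by a chain of adjacent cells, each containing an entry, and the
    inequalities compose along the chain. *)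
Lemma standardP (R n : nat) (lam rho : R.-tuple nat) (T : filling lam rho) :
  (forall i, tnth lam i = n) ->
  reflect ((forall c, #|[set x | T x == c]| = tnth rho (tag c)) /\
           (forall x y, southeast (T x) (T y) -> x < y))
          (standard T).
Proof.
move=> lamE; rewrite /standard /constrained.
apply: (iffP andP) => [[/forallP cellT ordT]|[cellT ordT]]; last first.
  split; first by apply/forallP => c; rewrite cellT.
  apply/forallP => x; apply/forallP => y; apply/implyP => xy; apply: ordT.
  by move: xy; case: ifP => // _; apply: adjacent_southeast.
have {}cellT c : #|[set x | T x == c]| = tnth rho (tag c) by apply/eqP.
split=> //; case: ifP ordT => [/forallP rho0|_] ordT x y; last first.
  by move/forallP/(_ x)/forallP/(_ y)/implyP: ordT.
have {}ordT u v : adjacent (T u) (T v) -> u < v.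
  by move/forallP/(_ u)/forallP/(_ v)/implyP: ordT.
(* Induction on the lattice distance between the two cells. *)
have [k] := ubnP (cell_row (T y) - cell_row (T x) + (cell_col (T y) - cell_col (T x))).
elim: k x => // k IHk x ltk /and3P[yx rxy cxy].
have [c adjc sec] : exists2 c : cell lam, adjacent (T x) c &
    (cell_row c <= cell_row (T y)) && (cell_col c <= cell_col (T y)).
  have ycol : cell_col (T y) < n.
    by rewrite /cell_col -[X in _ < X](lamE (tag (T y))).
  (* Step right while the columns differ, then down; the shape being a rectangle, the cell reached
     exists. *)
  move: cxy; rewrite leq_eqVlt => /predU1P[eqc|ltc].
    have ltr : cell_row (T x) < cell_row (T y).
      rewrite ltn_neqAle rxy andbT; apply: contra yx => /eqP eqr.
      by rewrite cell_eqE eqr eqc !eqxx.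
    have iR : (cell_row (T x)).+1 < R by apply: leq_ltn_trans ltr (ltn_ord _).
    have [c tc cc] := cell_exists (Ordinal iR) lamE ycol.
    have rc : cell_row c = (cell_row (T x)).+1 by rewrite /cell_row tc.
    exists c; first by rewrite /adjacent rc cc eqc !eqxx.
    by rewrite rc cc ltr leqnn.
  have [c tc cc] := cell_exists (tag (T x)) lamE (leq_ltn_trans ltc ycol).
  have rc : cell_row c = cell_row (T x) by rewrite /cell_row tc.
  exists c; first by rewrite /adjacent rc cc !eqxx orbT.
  by rewrite rc cc rxy.
have /card_gt0P[z] : 0 < #|[set x | T x == c]| by rewrite cellT.
rewrite inE => /eqP Tz; have xz : x < z by apply: ordT; rewrite Tz.
have [Tyz|Tyz] := eqVneq (T y) (T z).
  by apply: ordT; rewrite Tyz Tz.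
apply: (ltn_trans xz); apply: IHk; last by rewrite /southeast Tyz Tz.
move: adjc sec ltk; rewrite Tz /adjacent.
by case/orP => /andP[/eqP -> /eqP ->] /andP[]; lia.
Qed.

(** * Ranks within a row *)

Definition prefix_count (R N : nat) (r : 'I_N -> 'I_R) (i : 'I_R) (t : nat) : nat :=
  #|[set y : 'I_N | (y < t) && (r y == i)]|.

Lemma prefix_count0 (R N : nat) (r : 'I_N -> 'I_R) (i : 'I_R) :
  prefix_count r i 0 = 0.
Proof. by apply: eq_card0 => y; rewrite inE. Qed.

Lemma prefix_countS (R N : nat) (r : 'I_N -> 'I_R) (i : 'I_R) (x : 'I_N) :
  prefix_count r i x.+1 = (r x == i) + prefix_count r i x.
Proof.
rewrite /prefix_count (cardsD1 x) inE ltnSn; congr (_ + _); apply: eq_card => y.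
by rewrite !inE ltnS andbA (ltn_neqAle y).
Qed.

Lemma leq_prefix_count (R N : nat) (r : 'I_N -> 'I_R) (i : 'I_R) (t u : nat) :
  t <= u -> prefix_count r i t <= prefix_count r i u.
Proof.
move=> tu; apply/subset_leq_card/subsetP => y; rewrite !inE => /andP[yt ->].
by rewrite (leq_trans yt tu).
Qed.

Lemma prefix_count_lt (R N : nat) (r : 'I_N -> 'I_R) (x : 'I_N) (t : nat) :
  x < t -> prefix_count r (r x) x < prefix_count r (r x) t.
Proof.
by move/(leq_prefix_count r (r x)); rewrite prefix_countS eqxx add1n.
Qed.

(** The ranks occurring in row [i] are 0, 1, 2, ..., each taken exactly once. *)
Lemma card_prefix_count_lt (R N : nat) (r : 'I_N -> 'I_R) (i : 'I_R) (q : nat) :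
  #|[set y | (r y == i) && (prefix_count r i y < q)]|
    = minn q (prefix_count r i N).
Proof.
suff H t : t <= N ->
    #|[set y : 'I_N | (y < t) && ((r y == i) && (prefix_count r i y < q))]|
    = minn q (prefix_count r i t).
  by rewrite -H //; apply: eq_card => y; rewrite !inE ltn_ord.
elim: t => [_|t IHt tN].
  by rewrite prefix_count0 minn0; apply: eq_card0 => y; rewrite inE.
rewrite (cardsD1 (Ordinal tN)) inE ltnSn /=.
have -> : [set y : 'I_N | (y < t.+1) && ((r y == i) && (prefix_count r i y < q))]
      :\ Ordinal tN
    = [set y : 'I_N | (y < t) && ((r y == i) && (prefix_count r i y < q))].
  by apply/setP => y; rewrite !inE ltnS andbA -(inj_eq val_inj) /= -ltn_neqAle.
have /= -> := prefix_countS r i (Ordinal tN); rewrite (IHt (ltnW tN)).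
by case: (r _ == i) => /=; lia.
Qed.

Lemma card_row_cols (R n : nat) (lam rho : R.-tuple nat) (T : filling lam rho)
    (i : 'I_R) (k : nat) :
  (forall i, tnth lam i = n) ->
  (forall c, #|[set x | T x == c]| = tnth rho (tag c)) -> k <= n ->
  #|[set y | (tag (T y) == i) && (cell_col (T y) < k)]| = tnth rho i * k.
Proof.
move=> lamE cellT; elim: k => [_|k IHk kn].
  by rewrite muln0; apply: eq_card0 => y; rewrite inE andbF.
have [c tc cc] := cell_exists i lamE kn.
have cardc : #|[set x | T x == c]| = tnth rho i by rewrite cellT tc.
rewrite mulnS -(IHk (ltnW kn)) -cardc addnC -cardsUI.
rewrite [X in _ = _ + X]eq_card0 => [|y]; last first.
  by rewrite !inE cell_eqE cc; lia.
rewrite addn0; apply: eq_card => y.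
by rewrite !inE cell_eqE /cell_row tc cc val_eqE ltnS leq_eqVlt orbC andb_orr.
Qed.

Lemma divn_unique (a d q : nat) : d * q <= a -> a < d * q.+1 -> a %/ d = q.
Proof.
case: d => [|d]; first by rewrite !mul0n.
move=> qa aq; apply/eqP; rewrite eqn_leq -ltnS ltn_divLR // leq_divRL //.
by rewrite mulnC aq mulnC.
Qed.

(** If [x] lies in column c of a row of density d, the d c entries of the row in earlier columns all
    precede [x], and the entries of the row up to and including [x] lie in the first c + 1 columns.
    So the rank of [x] is at least d c and less than d (c + 1). *)
Lemma standard_col (R n : nat) (lam rho : R.-tuple nat) (T : filling lam rho) x :
  (forall i, tnth lam i = n) -> standard T ->
  cell_col (T x) =
    prefix_count (fun y => tag (T y)) (tag (T x)) x %/ tnth rho (tag (T x)).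
Proof.
move=> lamE /(standardP _ lamE)[cellT ordT].
have col_lt y : cell_col (T y) < n.
  by rewrite /cell_col -[X in _ < X](lamE (tag (T y))).
apply/esym/divn_unique.
  rewrite -(card_row_cols _ lamE cellT (ltnW (col_lt x))).
  apply/subset_leq_card/subsetP => y; rewrite !inE => /andP[/eqP eqr ltc].
  rewrite eqr eqxx andbT; apply: ordT.
  by rewrite /southeast cell_eqE /cell_row eqr leqnn ltnW // andbT eqxx gtn_eqF.
rewrite -(card_row_cols _ lamE cellT (col_lt x)) -add1n.
rewrite (_ : 1 + _ = prefix_count (fun y => tag (T y)) (tag (T x)) x.+1); last first.
  by rewrite prefix_countS eqxx.
apply/subset_leq_card/subsetP => y; rewrite !inE => /andP[yx /eqP eqr].
rewrite eqr eqxx ltnS leqNgt; apply: contraL yx => ltc; rewrite ltnS -ltnNge ordT //.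
by rewrite /southeast cell_eqE /cell_row eqr leqnn ltnW // andbT eqxx gtn_eqF.
Qed.

(** Let c be the rightmost column that row [j] has reached before [t]. Row [j] has then used at most
    c + 1 columns' worth of entries, while all entries of row [i] in columns up to c precede an
    entry of row [j] in column c, hence have been used too. *)
Lemma standard_balanced (R n : nat) (lam rho : R.-tuple nat) (T : filling lam rho)
    (i j : 'I_R) (t : nat) :
  (forall i, tnth lam i = n) -> standard T -> i < j ->
  tnth rho i * prefix_count (fun y => tag (T y)) j t
    <= tnth rho j * prefix_count (fun y => tag (T y)) i t.
Proof.
move=> lamE /(standardP _ lamE)[cellT ordT] ij.
have [->|] := posnP (prefix_count (fun y => tag (T y)) j t); first by rewrite muln0.
case/card_gt0P => y0; rewrite inE => y0P.
case: (@arg_maxnP _ y0 (fun y => (y < t) && (tag (T y) == j))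
  (fun y => cell_col (T y)) y0P).
move=> y /andP[yt /eqP yj] ymax.
have col_lt : cell_col (T y) < n.
  by rewrite /cell_col -[X in _ < X](lamE (tag (T y))).
apply: (@leq_trans (tnth rho i * (tnth rho j * (cell_col (T y)).+1))).
  rewrite leq_mul2l -(card_row_cols _ lamE cellT col_lt); apply/orP; right.
  apply/subset_leq_card/subsetP => z; rewrite !inE => /andP[zt zj].
  by rewrite zj ltnS; apply: ymax; rewrite zt zj.
rewrite mulnCA leq_mul2l -(card_row_cols _ lamE cellT col_lt); apply/orP; right.
apply/subset_leq_card/subsetP => z; rewrite !inE => /andP[/eqP zi zc].
rewrite zi eqxx andbT (leq_trans _ yt) // ltnS ltnW // ordT //.
rewrite /southeast cell_eqE /cell_row yj zi (ltnW ij) -ltnS zc !andbT.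
by rewrite gtn_eqF.
Qed.

(** The largest entry is read first, so that dropping letters from the head leaves the row sequence
    of the smallest entries. *)
Definition row_word (R N : nat) (r : 'I_N -> 'I_R) : N.-tuple 'I_R :=
  [tuple r (rev_ord x) | x < N].

Lemma count_drop_row_word (R N : nat) (r : 'I_N -> 'I_R) (i : 'I_R) (t : nat) :
  count_mem i (drop t (row_word r)) = prefix_count r i (N - t).
Proof.
case: (leqP N t) => [Nt|/ltnW tN].
  by rewrite drop_oversize ?size_tuple //= (eqP Nt) prefix_count0.
rewrite -{1}(subKn tN); have := leq_subr t N; elim: (N - t) => [_|s IHs sN].
  by rewrite subn0 drop_oversize ?size_tuple // prefix_count0.
have /= -> := prefix_countS r i (Ordinal sN); rewrite -(IHs (ltnW sN)).
have ltN : N - s.+1 < N by lia.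
rewrite (drop_nth (r (Ordinal sN))) ?(size_tuple (row_word r)) // subnSK //.
have nthE := tnth_nth (r (Ordinal sN)) (row_word r) (Ordinal ltN).
rewrite -{}nthE tnth_mktuple.
by congr ((r _ == i) + _); apply: val_inj => /=; lia.
Qed.

(** Cross-multiplied comparison of count over density; a row of density 0 below or above a row of
    density 1 gets no letters or imposes no bound, respectively. *)
Definition balanced (R : nat) (rho : R.-tuple nat) (w : seq 'I_R) : bool :=
  [forall i : 'I_R, forall j : 'I_R, (i < j) ==>
    (tnth rho i * count_mem j w <= tnth rho j * count_mem i w)].

(* Words are written backwards, so that the prefixes of the usual ballot condition
   are the suffixes here. *)
Fixpoint ballot (R : nat) (rho : R.-tuple nat) (w : seq 'I_R) : bool :=
  if w is _ :: w' then balanced rho w && ballot rho w' else true.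

Lemma ballotP (R : nat) (rho : R.-tuple nat) (w : seq 'I_R) :
  reflect (forall t, balanced rho (drop t w)) (ballot rho w).
Proof.
apply: (iffP idP).
  elim: w => [_ t|a w IHw /andP[aw /IHw wt] [|t]]; [|exact: aw|exact: wt].
  by apply/forallP => i; apply/forallP => j; rewrite !muln0 implybT.
elim: w => [//|a w IHw aw]; apply/andP; split; first exact: (aw 0).
by apply: IHw => t; apply: (aw t.+1).
Qed.

(** The map is [row_word] of the row function. It is injective because [standard_col] recovers the
    columns, and its inverse puts a letter in the column given by its rank divided by the
    density. *)
Lemma card_svt_ballot (R n : nat) (lam rho : R.-tuple nat) :
  (forall i, tnth lam i = n) ->
  (forall i j : 'I_R, i < j -> tnth rho i = 1 \/ tnth rho j = 1) ->
  #|svt lam rho| =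
    #|[set w : (total_entries lam rho).-tuple 'I_R |
        ballot rho w && [forall i, count_mem i w == n * tnth rho i]]|.
Proof.
move=> lamE rho1; set N := total_entries lam rho.
pose f (T : filling lam rho) := row_word (fun x => tag (T x)).
have f_inj : {in svt lam rho &, injective f}.
  move=> T U; rewrite !inE => stdT stdU eqf.
  have eq_tag x : tag (T x) = tag (U x).
    by move/(congr1 (fun w => tnth w (rev_ord x))): eqf; rewrite !tnth_mktuple rev_ordK.
  apply/ffunP => x; apply/eqP; rewrite cell_eqE /cell_row eq_tag eqxx /=.
  rewrite (standard_col _ lamE stdT) (standard_col _ lamE stdU) eq_tag.
  by apply/eqP; congr (_ %/ _); apply: eq_card => y; rewrite !inE eq_tag.
rewrite -(card_in_imset f_inj); apply: eq_card => w; rewrite inE.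
apply/imsetP/andP => [[T]|[/ballotP wbal /forallP wtot]].
  rewrite inE => stdT ->; split.
    apply/ballotP => t; apply/forallP => i; apply/forallP => j; apply/implyP => ij.
    by rewrite !count_drop_row_word; apply: standard_balanced ij.
  have /(standardP _ lamE)[cellT _] := stdT.
  apply/forallP => i; rewrite -[X in count_mem i X]drop0 count_drop_row_word subn0.
  rewrite mulnC -(card_row_cols i lamE cellT (leqnn n)); apply/eqP/eq_card => y.
  by rewrite !inE ltn_ord /= andbC /cell_col -[X in _ < X](lamE (tag (T y))) ltn_ord.
pose r x := tnth w (rev_ord x); pose rank x := prefix_count r (r x) x.
have wE : w = row_word r.
  by apply: eq_from_tnth => x; rewrite tnth_mktuple /r rev_ordK.
have tot i : prefix_count r i N = n * tnth rho i.
  by rewrite -(eqP (wtot i)) wE -[X in count_mem i X]drop0 count_drop_row_word subn0.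
have bal (i j : 'I_R) t : i < j -> t <= N ->
    tnth rho i * prefix_count r j t <= tnth rho j * prefix_count r i t.
  move=> ij tN; have /forallP/(_ i)/forallP/(_ j)/implyP/(_ ij) := wbal (N - t).
  by rewrite wE !count_drop_row_word subKn.
have rank_lt x : rank x < n * tnth rho (r x).
  by rewrite -tot; apply: prefix_count_lt.
have rho_gt0 x : 0 < tnth rho (r x).
  by have := rank_lt x; case: (tnth rho _) => //; rewrite muln0.
have col_lt x : rank x %/ tnth rho (r x) < tnth lam (r x).
  by rewrite lamE ltn_divLR.
pose T : filling lam rho :=
  [ffun x => Tagged (fun i => 'I_(tnth lam i)) (Ordinal (col_lt x))].
have tagT x : tag (T x) = r x by rewrite ffunE.
have colT x : cell_col (T x) = rank x %/ tnth rho (r x) by rewrite ffunE.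
exists T; last by rewrite wE; apply: eq_from_tnth => x; rewrite !tnth_mktuple tagT.
rewrite inE; apply/(standardP _ lamE); split => [c|x y].
  have [rho0|rho0] := posnP (tnth rho (tag c)).
    rewrite rho0; apply: eq_card0 => x; rewrite inE; apply/negP => /eqP Tx.
    by have := rho_gt0 x; rewrite -tagT Tx rho0.
  set i := tag c; set j := cell_col c; have jn : j < n.
    by rewrite /j /cell_col -[X in _ < X](lamE (tag c)).
  have cols k : k <= n ->
      #|[set y | (r y == i) && (prefix_count r i y < tnth rho i * k)]| = tnth rho i * k.
    move=> kn; rewrite card_prefix_count_lt -/N tot mulnC; apply/minn_idPl.
    by rewrite leq_mul2r kn orbT.
  (* The content of a cell is the difference of two initial blocks of columns of its row. *)
  have -> : tnth rho i = tnth rho i * j.+1 - tnth rho i * j by rewrite mulnS addnK.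
  rewrite -(cols _ jn) -(cols _ (ltnW jn)) -cardsDS; last first.
    apply/subsetP => y; rewrite !inE => /andP[-> /leq_trans]; apply.
    by rewrite leq_mul2l leqnSn orbT.
  apply: eq_card => y; rewrite !inE cell_eqE /cell_row tagT val_eqE colT /rank -/i -/j.
  case: eqP => //= ->; rewrite -leqNgt eqn_leq -ltnS ltn_divLR // leq_divRL //.
  by rewrite andbC !(mulnC (tnth rho i)).
rewrite /southeast cell_eqE /cell_row !tagT !colT => /and3P[yx rxy cxy].
rewrite ltnNge; apply/negP => leyx; move: rxy; rewrite leq_eqVlt val_eqE.
case/predU1P => [eqr|ltr].
  have ltc : rank x %/ tnth rho (r x) < rank y %/ tnth rho (r y).
    by rewrite ltn_neqAle cxy andbT; apply: contra yx => /eqP ->; rewrite eqr !eqxx.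
  move: ltc; rewrite ltnNge => /negP; apply.
  by rewrite /rank eqr leq_div2r // leq_prefix_count.
have ltyx : y < x.
  rewrite ltn_neqAle leyx andbT; apply: contraTneq ltr => /val_inj ->.
  by rewrite ltnn.
(* With a and b the densities of the rows of [x] and [y], balance just after [y] and the column
   inequality together give a + b <= a b, which fails when a or b is 1. *)
have := bal _ _ y.+1 ltr (ltn_ord y).
rewrite (prefix_countS r (r y) y) eqxx -/(rank y).
have := leq_prefix_count r (r x) ltyx; rewrite -/(rank x).
have := ltn_ceil (rank x) (rho_gt0 x); have := leq_trunc_div (rank y) (tnth rho (r y)).
move: cxy; move: (prefix_count _ _ _) (rank x %/ _) (rank y %/ _).
by case: (rho1 _ _ ltr) => ->; nia.
Qed.

(** * Recurrence for the number of ballot words *)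

Definition feasible (m i g j : nat) : bool :=
  [&& g <= m * i, j <= i & m * j <= g].

(** The length [t] serves as fuel, since each recursive call decreases only one of the three
    counts. *)
Fixpoint ballot_count_len (m t i g j : nat) : nat :=
  if t is t'.+1 then
    if feasible m i g j then
      (if i is i'.+1 then ballot_count_len m t' i' g j else 0)
      + (if g is g'.+1 then ballot_count_len m t' i g' j else 0)
      + (if j is j'.+1 then ballot_count_len m t' i g j' else 0)
    else 0
  else [&& i == 0, g == 0 & j == 0].

Definition ballot_count (m i g j : nat) : nat :=
  ballot_count_len m (i + g + j) i g j.

Lemma ballot_countE (m i g j : nat) :
  ballot_count m i g j =
    if feasible m i g j then
      [&& i == 0, g == 0 & j == 0]
      + (if i is i'.+1 then ballot_count m i' g j else 0)
      + (if g is g'.+1 then ballot_count m i g' j else 0)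
      + (if j is j'.+1 then ballot_count m i g j' else 0)
    else 0.
Proof.
rewrite /ballot_count; case: i g j => [|i] [|g] [|j];
  by rewrite ?addSn ?addnS ?addSn //= ?addn0 // /feasible !muln0.
Qed.


Lemma ballot_count_infeasible (m i g j : nat) :
  ~~ feasible m i g j -> ballot_count m i g j = 0.
Proof. by rewrite ballot_countE => /negbTE ->. Qed.

Lemma card_cons_tuple (A : finType) (t : nat) (P : pred (seq A)) :
  #|[set w : t.+1.-tuple A | P w]| =
    \sum_(a : A) #|[set w : t.-tuple A | P (a :: w)]|.
Proof.
under eq_bigr do rewrite -sum1dep_card.
rewrite pair_big_dep /= -sum1dep_card.
rewrite (reindex (fun p : A * t.-tuple A => [tuple of p.1 :: p.2])) //=.
exists (fun w => (thead w, [tuple of behead w])) => [[a w]|w] _ /=.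
  by congr pair; apply: val_inj.
by apply: val_inj; rewrite /= [in RHS](tuple_eta w).
Qed.

Definition row0 : 'I_3 := @Ordinal 3 0 isT.
Definition row1 : 'I_3 := @Ordinal 3 1 isT.
Definition row2 : 'I_3 := @Ordinal 3 2 isT.

Lemma forall_ord3 (P : pred 'I_3) :
  [forall i, P i] = [&& P row0, P row1 & P row2].
Proof.
apply/forallP/and3P => [Pall|[P0 P1 P2]]; first by split.
by case=> [[|[|[|//]]] lti]; [move: P0|move: P1|move: P2];
  congr (is_true (P _)); apply: val_inj.
Qed.

Lemma balanced3 (m : nat) (w : seq 'I_3) :
  balanced [tuple 1; m; 1] w =
    feasible m (count_mem row0 w) (count_mem row1 w) (count_mem row2 w).
Proof.
rewrite /balanced !forall_ord3 /= !(tnth_nth 0) /= !mul1n.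
by rewrite /feasible !andbT andbA.
Qed.

(** Split by the head letter: once its counts are fixed, the balance of the whole word is just
    [feasible m i g j]. *)
Lemma card_ballot_words (m t i g j : nat) :
  #|[set w : t.-tuple 'I_3 | ballot [tuple 1; m; 1] w &&
      [&& count_mem row0 w == i, count_mem row1 w == g & count_mem row2 w == j]]|
    = ballot_count_len m t i g j.
Proof.
have sum_ord3 (F : 'I_3 -> nat) : \sum_a F a = F row0 + F row1 + F row2.
  rewrite !big_ord_recl big_ord0 addn0 addnA.
  by congr (F _ + F _ + F _); apply: val_inj.
elim: t i g j => [|t IHt] i g j.
  rewrite /= (eq_sym i) (eq_sym g) (eq_sym j); case E: [&& _, _ & _].
    by apply: (@eq_card1 _ [tuple]) => w; rewrite !inE [w]tuple0 /= E eqxx.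
  by apply: eq_card0 => w; rewrite inE [w]tuple0 /= E.
rewrite (card_cons_tuple t (fun w => ballot [tuple 1; m; 1] w &&
  [&& count_mem row0 w == i, count_mem row1 w == g & count_mem row2 w == j])).
rewrite [in RHS]/=; case: ifP => feas; last first.
  apply: big1 => a _; apply: eq_card0 => w; rewrite inE; apply/negP.
  case/andP => /andP[+ _] /and3P[/eqP c0 /eqP c1 /eqP c2].
  by rewrite balanced3 c0 c1 c2 feas.
have step a (w : seq 'I_3) : ballot [tuple 1; m; 1] (a :: w) &&
    [&& count_mem row0 (a :: w) == i, count_mem row1 (a :: w) == g
      & count_mem row2 (a :: w) == j]
    = ballot [tuple 1; m; 1] w && [&& count_mem row0 (a :: w) == i,
        count_mem row1 (a :: w) == g & count_mem row2 (a :: w) == j].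
  apply: andb_id2r => /and3P[/eqP c0 /eqP c1 /eqP c2].
  by rewrite -[LHS]/(balanced _ (a :: w) && ballot _ w) balanced3 c0 c1 c2 feas.
rewrite sum_ord3; congr (_ + _ + _).
- case: i {feas} step => [|i] step; last rewrite -IHt; [apply: eq_card0|apply: eq_card];
    by move=> w; rewrite !inE step /= ?eqSS ?andbF.
- case: g {feas} step => [|g] step; last rewrite -IHt; [apply: eq_card0|apply: eq_card];
    by move=> w; rewrite !inE step /= ?eqSS ?andbF.
- case: j {feas} step => [|j] step; last rewrite -IHt; [apply: eq_card0|apply: eq_card];
    by move=> w; rewrite !inE step /= ?eqSS ?andbF.
Qed.

Lemma catalan3E (k n : nat) :
  catalan3 k n = ballot_count (k - 1) n ((k - 1) * n) n.
Proof.
rewrite /catalan3 (@card_svt_ballot 3 n); first last.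
- rewrite /= => i j; rewrite !(tnth_nth 0).
  by case: i j => [[|[|[|//]]] lti] [[|[|[|//]]] ltj] //=; auto.
- by case=> [[|[|[|//]]] lti]; rewrite (tnth_nth 0).
rewrite /ballot_count -card_ballot_words.
have -> : total_entries (rect3 n) [tuple 1; k - 1; 1] = n + (k - 1) * n + n.
  rewrite /total_entries !big_ord_recl big_ord0 !(tnth_nth 0) /=; lia.
apply: eq_card => w; rewrite !inE forall_ord3 !(tnth_nth 0) /=.
by rewrite !muln1 (mulnC n).
Qed.

(** * Polynomiality *)

Local Open Scope ring_scope.

Definition poly_lt (e : nat) (f : nat -> rat) : Prop :=
  exists2 p : {poly rat}, (size p <= e)%N
    & forall m : nat, (0 < m)%N -> f m = p.[m%:R].

(** Total degree less than [e] in [m] and [s], written in the binomial basis in [s], where summation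
    over [s] becomes a shift of index. *)
Definition strip_poly_lt (e : nat) (f : nat -> nat -> rat) : Prop :=
  exists2 u : nat -> {poly rat}, (forall k, (size (u k) <= e - k)%N)
    & forall m s : nat, (0 < m)%N -> (s <= m)%N ->
      f m s = \sum_(k < e) (u k).[m%:R] * 'C(s, k)%:R.

Lemma eq_poly_lt (e : nat) (f g : nat -> rat) :
  (forall m, (0 < m)%N -> f m = g m) -> poly_lt e g -> poly_lt e f.
Proof. by move=> fg [p sp gE]; exists p => // m m0; rewrite fg ?gE. Qed.

Lemma poly_lt_leq (e e' : nat) (f : nat -> rat) :
  (e <= e')%N -> poly_lt e f -> poly_lt e' f.
Proof. by move=> le_e [p sp fE]; exists p => //; apply: leq_trans le_e. Qed.

Lemma poly_ltD (e : nat) (f g : nat -> rat) :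
  poly_lt e f -> poly_lt e g -> poly_lt e (fun m => f m + g m).
Proof.
move=> [p sp fE] [q sq gE]; exists (p + q).
  by rewrite (leq_trans (size_polyD _ _)) // geq_max sp.
by move=> m m0; rewrite hornerD fE ?gE.
Qed.

Lemma poly_lt_const (e : nat) (c : rat) :
  (0 < e)%N -> poly_lt e (fun=> c).
Proof.
move=> e0; exists c%:P => [|m _]; last by rewrite hornerC.
exact: leq_trans (size_polyC_leq1 _) e0.
Qed.

Lemma strip_poly_lt0 (e : nat) : strip_poly_lt e (fun _ _ => 0).
Proof.
exists (fun=> 0) => [k|m s _ _]; first by rewrite size_poly0.
by rewrite big1 // => k _; rewrite horner0 mul0r.
Qed.

Lemma strip_poly_ltD (e : nat) (f g : nat -> nat -> rat) :
  strip_poly_lt e f -> strip_poly_lt e g ->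
  strip_poly_lt e (fun m s => f m s + g m s).
Proof.
move=> [u su fE] [v sv gE]; exists (fun k => u k + v k) => [k|m s m0 sm].
  by rewrite (leq_trans (size_polyD _ _)) // geq_max su sv.
rewrite fE // gE // -big_split; apply: eq_bigr => k _ /=.
by rewrite hornerD mulrDl.
Qed.

Lemma strip_poly_lt_bottom (e : nat) (f : nat -> nat -> rat) :
  strip_poly_lt e f -> poly_lt e (fun m => f m 0%N).
Proof.
case=> u su fE; exists (u 0%N) => [|m m0]; first by rewrite -[e]subn0.
rewrite fE //; case: e su {fE} => [|e] su.
  have /eqP : u 0%N == 0 by rewrite -size_poly_leq0.
  by move->; rewrite big_ord0 horner0.
by rewrite big_ord_recl bin0 mulr1 big1 ?addr0 // => k _; rewrite bin0n mulr0.
Qed.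

Definition bin_poly (k : nat) : {poly rat} :=
  (k`!)%:R^-1 *: \prod_(i < k) ('X - i%:R%:P).

Lemma size_bin_poly (k : nat) : (size (bin_poly k) <= k.+1)%N.
Proof.
rewrite (leq_trans (size_scale_leq _ _)) // -big_enum /=.
by rewrite size_prod_XsubC size_enum_ord.
Qed.

Lemma horner_bin_poly (k m : nat) : (bin_poly k).[m%:R] = 'C(m, k)%:R.
Proof.
have fact_neq0 : (k`!)%:R != 0 :> rat by rewrite pnatr_eq0 -lt0n fact_gt0.
apply: (mulfI fact_neq0); rewrite hornerZ mulVKf // mulrC -natrM bin_ffact.
elim: k {fact_neq0} => [|k IHk]; first by rewrite big_ord0 hornerC.
rewrite big_ord_recr hornerM IHk /= hornerXsubC ffactnSr natrM.
case: (leqP k m) => [km|/ffact_small ->]; first by rewrite natrB.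
by rewrite !mul0r.
Qed.

(** At s = m the basis element of index k becomes a polynomial of degree k in [m], so the total
    degree bound carries over. *)
Lemma strip_poly_lt_top (e : nat) (f : nat -> nat -> rat) :
  strip_poly_lt e f -> poly_lt e (fun m => f m m).
Proof.
case=> u su fE; exists (\sum_(k < e) u k * bin_poly k) => [|m m0]; last first.
  by rewrite fE // horner_sum; apply: eq_bigr => k _; rewrite hornerM horner_bin_poly.
apply: (leq_trans (size_sum _ _ _)); apply/bigmax_leqP => k _.
apply: (leq_trans (size_polyMleq _ _)).
by have := su k; have := size_bin_poly k; have := ltn_ord k; lia.
Qed.

(* Pascal's rule: summing binom(s', k) over 0 < s' <= s gives
   binom(s, k+1) + binom(s, k), minus 1 when k = 0. *)
Lemma strip_poly_lt_sum (e : nat) (f h : nat -> nat -> rat) :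
  poly_lt e.+1 (fun m => f m 0%N) -> strip_poly_lt e h ->
  (forall m s, (0 < m)%N -> (s < m)%N -> f m s.+1 = f m s + h m s.+1) ->
  strip_poly_lt e.+1 f.
Proof.
move=> [p sp f0] [u su hE] fS.
pose v k := if k is k'.+1 then u k' + u k else p.
exists v => [[|k]|m s m0]; first by [].
  rewrite (leq_trans (size_polyD _ _)) // geq_max; have := (su k, su k.+1).
  by case; lia.
have ue0 : u e = 0 by apply/eqP; rewrite -size_poly_leq0 -(subnn e).
elim: s => [_|s IHs sm].
  rewrite f0 // big_ord_recl bin0 mulr1 big1 ?addr0 // => k _.
  by rewrite bin0n mulr0.
rewrite fS // IHs ?hE // 1?ltnW // !(big_ord_recl e) !bin0 -!addrA; congr (_ + _).
have -> : \sum_(i < e) (v (lift ord0 i)).[m%:R] * 'C(s.+1, lift ord0 i)%:R =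
    \sum_(i < e) (v i.+1).[m%:R] * 'C(s, i.+1)%:R +
    \sum_(i < e) (v i.+1).[m%:R] * 'C(s, i)%:R.
  rewrite -big_split; apply: eq_bigr => k _ /=.
  by rewrite /bump /= add1n binS natrD mulrDr.
congr (_ + _); apply/eqP; rewrite -subr_eq0 -sumrB.
(* By Pascal's rule the difference of binomials is the binomial of s over i - 1. The term i = 0
   vanishes, and [u e = 0] makes up for the missing last one. *)
have shift : \sum_(i < e) (u i.+1).[m%:R] * 'C(s, i)%:R =
    \sum_(i < e) (u i).[m%:R] * ('C(s.+1, i)%:R - 'C(s, i)%:R).
  have := @big_ord_recr rat 0 +%R e
    (fun i => (u i).[m%:R] * ('C(s.+1, i)%:R - 'C(s, i)%:R)).
  rewrite /= ue0 horner0 mul0r addr0 => <-.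
  rewrite big_ord_recl !bin0 subrr mulr0 add0r; apply: eq_bigr => k _.
  by rewrite lift0 binS natrD addrC addKr.
rewrite (eq_bigr (fun i : 'I_e => (u i).[m%:R] * ('C(s.+1, i)%:R - 'C(s, i)%:R)
    - (u i.+1).[m%:R] * 'C(s, i)%:R)) => [|k _].
  by rewrite sumrB -shift subrr.
by rewrite /= hornerD; ring.
Qed.

(** * Ballot counts on strips *)

Lemma ballot_count_line (m i : nat) : ballot_count m i 0 0 = 1%N.
Proof.
elim: i => [|i IHi]; rewrite ballot_countE /feasible !muln0 //= IHi.
by rewrite !addn0.
Qed.

(** Strictly above g = m t, removing a letter 0 stays feasible only if t < i - 1, as otherwise g
    exceeds m (i - 1). *)
Lemma ballot_count_strip_step (m t i j s : nat) :
  (t < i)%N -> (j <= t)%N -> (s < m)%N ->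
  ballot_count m i (m * t + s.+1) j =
    (ballot_count m i (m * t + s) j
     + ((if t < i.-1 then ballot_count m i.-1 (m * t + s.+1) j else 0)
        + (if 0 < j then ballot_count m i (m * t + s.+1) j.-1 else 0)))%N.
Proof.
case: i => // i ti jt sm; rewrite [LHS]ballot_countE ifT; last first.
  by rewrite /feasible; apply/and3P; split; nia.
rewrite addnS /= add0n [RHS]addnCA addnA; congr (_ + _ + _)%N; last by case: j {jt}.
case: ltnP => // it.
by apply: ballot_count_infeasible; rewrite /feasible; nia.
Qed.

(** Here the bound m (j + 1) <= g is attained, so the last letter cannot be a 1. *)
Lemma ballot_count_corner (m i j : nat) :
  (0 < m)%N -> (j < i)%N ->
  ballot_count m i (m * j.+1) j.+1 =
    ((if j.+1 < i then ballot_count m i.-1 (m * j.+1) j.+1 else 0)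
     + ballot_count m i (m * j.+1) j)%N.
Proof.
case: i => // i m0 ji; rewrite ballot_countE ifT; last first.
  by rewrite /feasible; apply/and3P; split; nia.
rewrite /= add0n ltnS; congr (_ + _)%N; rewrite -[RHS]addn0; congr (_ + _)%N.
  by case: ltnP => // ij; apply: ballot_count_infeasible; rewrite /feasible; nia.
case E: (m * j.+1)%N => [|g] //.
by apply: ballot_count_infeasible; rewrite /feasible; nia.
Qed.

Definition strip_count (t i j m s : nat) : rat :=
  (ballot_count m i (m * t + s) j)%:R.

(* Along a strip [m * t <= g <= m * t.+1] the feasible pairs (i, j) do not change,
   so the recurrence there is a plain summation over g; neighbouring strips
   interact only through the values at their common boundary. *)
Lemma strip_count_poly_boundary (t : nat) :
  (forall i j, (t < i)%N -> (j <= t)%N ->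
     ((t < i.-1)%N -> strip_poly_lt (i.-1 + j) (strip_count t i.-1 j)) ->
     poly_lt (i + j) (fun m => strip_count t i j m 0)) ->
  forall i j, (t < i)%N -> (j <= t)%N ->
    strip_poly_lt (i + j) (strip_count t i j).
Proof.
move=> boundary; elim=> // i IHi; elim=> [|j IHj] ti jt.
  rewrite addSn; apply: (strip_poly_lt_sum
    (h := fun m s => if (t < i)%N then strip_count t i 0 m s else 0)).
  - by apply: (boundary i.+1 0%N) => // it; apply: IHi.
  - by case: ltnP => it; [apply: IHi | apply: strip_poly_lt0].
  - move=> m s m0 sm; rewrite /strip_count ballot_count_strip_step //= addn0 natrD.
    by case: ifP.
rewrite addSn; apply: (strip_poly_lt_sum
  (h := fun m s => (if (t < i)%N then strip_count t i j.+1 m s else 0)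
                   + strip_count t i.+1 j m s)).
- by apply: (boundary i.+1 j.+1) => // it; apply: IHi.
- apply: strip_poly_ltD; last by rewrite addnS -addSn; apply: IHj => //; apply: ltnW.
  by case: ltnP => it; [apply: IHi | apply: strip_poly_lt0].
- move=> m s m0 sm; rewrite /strip_count ballot_count_strip_step //= !natrD.
  by case: ifP.
Qed.

(** Induction on the strip. For j <= t the values at the bottom of strip t + 1 are those at the top
    of strip t; for j = t + 1, which becomes feasible only there, they come from the corner
    recurrence. *)
Lemma strip_count_poly (t i j : nat) : (t < i)%N -> (j <= t)%N ->
  strip_poly_lt (i + j) (strip_count t i j).
Proof.
elim: t i j => [|t IHt]; apply: strip_count_poly_boundary => i j ti jt.
  move: jt; rewrite leqn0 => /eqP -> _; rewrite addn0.
  apply: (eq_poly_lt _ (poly_lt_const 1 ti)) => m _.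
  by rewrite /strip_count muln0 ballot_count_line.
have top i' j' : (t < i')%N -> (j' <= t)%N ->
    poly_lt (i' + j') (fun m => (ballot_count m i' (m * t.+1) j')%:R).
  move=> ti' jt'; apply: (eq_poly_lt _ (strip_poly_lt_top (IHt _ _ ti' jt'))).
  by move=> m _; rewrite /strip_count mulnS addnC.
move: jt; rewrite leq_eqVlt => /predU1P [->|jt] IHi; last first.
  by apply: (eq_poly_lt _ (top _ _ (ltnW ti) jt)) => m _; rewrite /strip_count addn0.
(* For i = t + 2 the pair (i - 1, j) is (t + 1, t + 1), feasible at a single g; a second use of the
   corner recurrence leads back to the top of strip t. *)
apply: (@eq_poly_lt _ _ (fun m =>
  (if (t.+1 < i.-1)%N then strip_count t.+1 i.-1 t.+1 m 0
   else if i == t.+2 then (ballot_count m t.+1 (m * t.+1) t)%:R else 0)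
  + (ballot_count m i (m * t.+1) t)%:R)).
  move=> m m0; rewrite /strip_count !addn0 ballot_count_corner ?(ltnW ti) // ti natrD.
  congr (_ + _); case: ltnP => // it.
  have -> : i = t.+2 by lia.
  by rewrite eqxx /= ballot_count_corner ?ltnn.
apply: poly_ltD; last by apply: poly_lt_leq (top _ _ (ltnW ti) _); lia.
case: ltnP => it.
  by apply: poly_lt_leq (strip_poly_lt_bottom (IHi _)); lia.
have -> : i = t.+2 by lia.
by rewrite eqxx; apply: poly_lt_leq (top _ _ _ _); lia.
Qed.

Lemma ballot_count_poly (n : nat) :
  poly_lt (n + n).+1 (fun m => (ballot_count m n.+1 (m * n.+1) n.+1)%:R).
Proof.
have top := strip_poly_lt_top (@strip_count_poly n n.+1 n _ _).
apply: (eq_poly_lt _ (poly_lt_leq _ (top _ _))) => //.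
move=> m m0; rewrite ballot_count_corner // ltnn /= add0n.
by rewrite /strip_count mulnS addnC.
Qed.

(** * Interpolation for n = 5 *)

(** The difference of the two polynomials would have the [e] roots 1, ..., e but degree less than
    [e]. *)
Lemma poly_lt_unique (e : nat) (f g : nat -> rat) :
  poly_lt e f -> poly_lt e g ->
  (forall m, (0 < m)%N -> (m <= e)%N -> f m = g m) ->
  forall m, (0 < m)%N -> f m = g m.
Proof.
move=> [p sp fE] [q sq gE] fg m m0; rewrite fE // gE //; congr horner.
apply/eqP; rewrite -subr_eq0; apply: contraT => pq0.
pose rs := [seq i%:R : rat | i <- iota 1 e].
have /(_ rs) := max_poly_roots pq0.
rewrite size_map size_iota ltnNge (leq_trans (size_polyD _ _)) ?size_polyN;
  last by rewrite geq_max sp.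
apply.
  apply/allP => _ /mapP[i + ->]; rewrite mem_iota add1n ltnS => /andP[i0 ie].
  by rewrite rootE hornerD hornerN -fE // -gE // fg // subrr.
by rewrite map_inj_uniq ?iota_uniq // => i j /eqP; rewrite eqr_nat => /eqP.
Qed.

Local Close Scope ring_scope.

(* Evaluation of the counts in binary *)
Delimit Scope N_scope with num.

(* [ballot_count] itself takes exponential time; these are its values along lines
   0 <= g < G, in binary. *)
Fixpoint scan_line (m i j g : nat) (acc : N) (inflow : seq N) : seq N :=
  if inflow is x :: s then
    let v := if feasible m i g j then (acc + x)%num else 0%num in
    v :: scan_line m i j g.+1 v s
  else [::].

(** The initial accumulator stands for the value at g = -1; its 1 at the origin accounts for the
    empty word. *)
Fixpoint ballot_line (m G i : nat) : nat -> seq N :=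
  let above := if i is i'.+1 then ballot_line m G i' else fun=> nseq G 0%num in
  fix line j :=
    let left := if j is j'.+1 then line j' else nseq G 0%num in
    scan_line m i j 0 (if (i == 0) && (j == 0) then 1 else 0)%num
      [seq (p.1 + p.2)%num | p <- zip (above j) left].

Lemma size_scan_line (m i j g : nat) (acc : N) (s : seq N) :
  size (scan_line m i j g acc s) = size s.
Proof. by elim: s g acc => //= x s IHs g acc; rewrite IHs. Qed.

Lemma nth_scan_line (m i j g : nat) (acc : N) (s : seq N) :
  (forall x, x < size s -> N.to_nat (nth 0%num s x) =
     (if i is i'.+1 then ballot_count m i' (g + x) j else 0)
     + (if j is j'.+1 then ballot_count m i (g + x) j' else 0)) ->
  N.to_nat acc =
    (if g is g'.+1 then ballot_count m i g' j else (i == 0) && (j == 0)) ->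
  forall x, x < size s ->
    N.to_nat (nth 0%num (scan_line m i j g acc s) x) = ballot_count m i (g + x) j.
Proof.
elim: s g acc => // y s IHs g acc inflow accE.
have headE : N.to_nat (if feasible m i g j then (acc + y)%num else 0%num)
    = ballot_count m i g j.
  rewrite ballot_countE; case: ifP => // _.
  rewrite N2Nat.inj_add accE (inflow 0) // addn0 /=.
  by case: g {inflow accE IHs} => [|g]; case: i => [|i]; case: j => [|j];
    rewrite /= ?addn0 ?add0n //; lia.
case=> [|x] xs; first by rewrite addn0.
rewrite -addSnnS; apply: IHs => // x' xs'.
by rewrite addSnnS; apply: (inflow x'.+1).
Qed.

Lemma ballot_lineP (m G i j : nat) :
  size (ballot_line m G i j) = G /\
  forall g, g < G ->
    N.to_nat (nth 0%num (ballot_line m G i j) g) = ballot_count m i g j.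
Proof.
elim: i j => [|i IHi]; elim=> [|j [szj IHj]].
all: rewrite /= size_scan_line size_map size_zip ?size_nseq.
all: rewrite ?(IHi _).1 ?szj minnn; split=> // g gG.
all: apply: (@nth_scan_line _ _ _ 0) => //.
all: rewrite ?size_map ?size_zip ?size_nseq ?(IHi _).1 ?szj ?minnn //.
all: move=> x xG; rewrite (nth_map (0%num, 0%num));
  last by rewrite size_zip ?size_nseq ?(IHi _).1 ?szj ?minnn.
all: rewrite nth_zip ?size_nseq ?(IHi _).1 ?szj //= N2Nat.inj_add.
all: rewrite ?nth_nseq ?xG ?(IHi _).2 ?IHj //.
Qed.

(** The claimed formula without denominator or subtraction: the negative terms are those of odd
    degree and move to the left, and both sides are in Horner form in the square of [k]. *)
Definition formula_holds (k : nat) : bool :=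
  let m := k - 1 in let K := N.of_nat k in let K2 := (K * K)%num in
  (576 * nth 0 (ballot_line m (m * 5).+1 5 5) (m * 5)
   + K * K2 * (204 + K2 * (72 + K2 * 10092))
   == K2 * (2628 + K2 * (5473 + K2 * (10258 + K2 * 15625))) + 576)%num.

(** The values k = 2, ..., 10 are the nine nodes m = 1, ..., 9 that determine a polynomial of degree
    at most 8; k = 1 is the separate case m = 0. *)
Lemma formula_holds_1_10 : all formula_holds (iota 1 10).
Proof. by vm_compute. Qed.

Lemma formula_holdsP (k : nat) : formula_holds k ->
  (576 * ballot_count (k - 1) 5 ((k - 1) * 5) 5
   + k ^ 3 * (204 + k ^ 2 * (72 + k ^ 2 * 10092))
   = k ^ 2 * (2628 + k ^ 2 * (5473 + k ^ 2 * (10258 + k ^ 2 * 15625))) + 576).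
Proof.
move=> /eqP/(congr1 N.to_nat).
rewrite !(N2Nat.inj_add, N2Nat.inj_mul) Nat2N.id (ballot_lineP _ _ _ _).2 //.
Qed.

Local Open Scope ring_scope.

Lemma ballot_count5 (k : nat) : (1 <= k)%N ->
  (ballot_count (k - 1) 5 ((k - 1) * 5) 5)%:R =
    (15625%:R * k%:R ^+ 8 - 10092%:R * k%:R ^+ 7 + 10258%:R * k%:R ^+ 6
     - 72%:R * k%:R ^+ 5 + 5473%:R * k%:R ^+ 4 - 204%:R * k%:R ^+ 3
     + 2628%:R * k%:R ^+ 2) / 576%:R + 1 :> rat.
Proof.
have [p szp pE] : exists2 p : {poly rat}, (size p <= 9)%N & forall x, p.[x] =
    (15625%:R * x ^+ 8 - 10092%:R * x ^+ 7 + 10258%:R * x ^+ 6 - 72%:R * x ^+ 5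
     + 5473%:R * x ^+ 4 - 204%:R * x ^+ 3 + 2628%:R * x ^+ 2) / 576%:R + 1.
  exists (Poly [:: 1; 0; 2628%:R / 576%:R; - (204%:R / 576%:R);
    5473%:R / 576%:R; - (72%:R / 576%:R); 10258%:R / 576%:R;
    - (10092%:R / 576%:R); 15625%:R / 576%:R]); first exact: size_Poly.
  by move=> x; rewrite horner_Poly; cbn [horner_rec]; field.
have small l : (0 < l <= 10)%N ->
    (ballot_count (l - 1) 5 ((l - 1) * 5) 5)%:R = p.[l%:R].
  move=> l10; have := allP formula_holds_1_10 l; rewrite mem_iota => /(_ l10).
  move/formula_holdsP/(congr1 (fun x => x%:R : rat)).
  rewrite pE !(natrD, natrM, natrX).
  move: (ballot_count _ _ _ _)%:R => B /(canRL (addrK _)) E.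
  have n576 : 576%:R != 0 :> rat by rewrite pnatr_eq0.
  by apply: (mulfI n576); apply: (etrans E); field.
move=> k1; rewrite -pE; case: (ltnP k 2) => [k2|k2].
  by apply: small; lia.
have -> : k%:R = (k - 1)%:R + 1 :> rat by rewrite natrB // subrK.
move: (k - 1)%N (subn_gt0 1 k); rewrite k2 => m m0.
apply: (poly_lt_unique (ballot_count_poly 4) (g := fun l => p.[l%:R + 1]) _ _ m0).
(* The formula is in k = m + 1, the interpolation in m. *)
- exists (p \Po ('X + 1%:P)) => [|l _]; first by rewrite size_comp_poly2 ?size_XaddC.
  by rewrite horner_comp; congr horner; rewrite !hornerE.
- move=> l l0 l9; have := small l.+1 l9.
  by rewrite subn1 -natr1; apply.
Qed.

Theorem proposition3p6 (k : nat) (hk : (1 <= k)%N) :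
  (catalan3 k 5)%:R =
    (15625%:R * k%:R ^+ 8 - 10092%:R * k%:R ^+ 7 + 10258%:R * k%:R ^+ 6
     - 72%:R * k%:R ^+ 5 + 5473%:R * k%:R ^+ 4 - 204%:R * k%:R ^+ 3
     + 2628%:R * k%:R ^+ 2) / 576%:R + 1 :> rat.
Proof. by rewrite catalan3E; apply: ballot_count5. Qed.
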